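(* Let $l,s,t$ be positive integers, $k=s+t$, and let $F_{l}^{\{s,t\}}$ be the $l$-hyperflower with $t$ twins and center of size $s$. Then the adjacency spectrum of the subdivision hypergraph $S(F_{l}^{\{s,t\}})$ consists of: (i) the eigenvalue $-\frac{k-2}{k-1}$ with multiplicity $l(t-1)$; (ii) the eigenvalue $-\frac{l(k-2)}{k-1}$ with multiplicity $s-1$; (iii) the two eigenvalues $\frac{(t-1)(k-2)\pm\sqrt{(t-1)^{2}(k-2)^{2}+4t(k-1)^{2}}}{2(k-1)}$, each with multiplicity $l-1$; (iv) the three roots of $(k-1)^{2}\lambda^{3}-(k-1)(k-2)(ls+t-l-1)\lambda^{2}-\{(ls+t)(k-1)^{2}+l(s+t-1)(k-2)^{2}\}\lambda-l(s+t)(k-1)(k-2)=0$.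
   Context: A hypergraph consists of a finite vertex set and hyperedges, which are vertex subsets of size at least $2$. For a $k$-uniform hypergraph (all hyperedges of size $k$) with vertices $v_1,\dots,v_N$, the adjacency matrix $A$ has $A_{ij}=\frac{d_{ij}}{k-1}$ for $i\neq j$, where $d_{ij}$ is the number of hyperedges containing both $v_i$ and $v_j$, and $A_{ii}=0$; the adjacency spectrum is the multiset of eigenvalues of $A$. The $l$-hyperflower with $t$ twins and center of size $s$, $F_l^{\{s,t\}}$, has vertex set $W\cup U_1\cup\dots\cup U_l$ (pairwise disjoint), where $W=\{w_1,\dots,w_s\}$ and $U_j=\{u^j_1,\dots,u^j_t\}$, and hyperedges $e_j=W\cup U_j$ for $j=1,\dots,l$; it is $(s+t)$-uniform. Subdivision of a hyperedge $e$ of cardinality $k$: add a new vertex $p_e$, delete $e$, and add the $k$ hyperedges $\{p_e\}\cup(e\setminus\{v\})$, $v\in e$. The subdivision hypergraph $S(H)$ is obtained by subdividing every hyperedge of $H$. *)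

(* Defs.v *)
From HB Require Import structures.
From mathcomp Require Import all_boot all_order all_algebra.

Set Implicit Arguments.
Unset Strict Implicit.
Unset Printing Implicit Defensive.

Import Order.TTheory GRing.Theory Num.Theory.
Local Open Scope ring_scope.

Record hypergraph (V : finType) := Hypergraph {
  hyperedges :> {set {set V}};
  hyperedge_card : forall e, e \in hyperedges -> (1 < #|e|)%N
}.

Definition uniform (V : finType) (k : nat) (H : hypergraph V) : Prop :=
  forall e, e \in hyperedges H -> #|e| = k.

Definition codegree (V : finType) (H : hypergraph V) (u v : V) : nat :=
  #|[set e in hyperedges H | (u \in e) && (v \in e)]|.

(* Only meaningful when [uniform k H]; vertices are listed as [enum V]. *)
Definition adjmx (R : fieldType) (V : finType) (k : nat) (H : hypergraph V) :
    'M[R]_#|V| :=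
  \matrix_(i, j) if i == j then 0
                 else (codegree H (enum_val i) (enum_val j))%:R / (k%:R - 1).

(* [rs] lists all the roots of [p], each repeated according to its
   multiplicity; in particular [p] splits over [R]. *)
Definition all_roots (R : fieldType) (p : {poly R}) (rs : seq R) : Prop :=
  p != 0 /\ p = lead_coef p *: \prod_(r <- rs) ('X - r%:P).

(* Multisets are sequences up to [perm_eq]; multiplicities are algebraic. *)
Definition spectrum (R : fieldType) (n : nat) (A : 'M[R]_n) (sp : seq R) :
    Prop :=
  all_roots (char_poly A) sp.

Lemma mem_spectrum (R : fieldType) (n : nat) (A : 'M[R]_n) (sp : seq R) :
  spectrum A sp -> forall a, (a \in sp) = eigenvalue A a.
Proof.
case=> pn0 eq_p a; rewrite eigenvalue_root_char eq_p rootZ ?lead_coef_eq0 //.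
by rewrite root_prod_XsubC.
Qed.

Lemma size_spectrum (R : fieldType) (n : nat) (A : 'M[R]_n) (sp : seq R) :
  spectrum A sp -> size sp = n.
Proof.
case=> pn0 eq_p; have := size_char_poly A.
by rewrite eq_p size_scale ?lead_coef_eq0 // size_prod_XsubC => -[].
Qed.

(* [inl i] is w_i and [inr (j, i)] is u^j_i. *)
Definition flower_vertex (l s t : nat) : finType := ('I_s + 'I_l * 'I_t)%type.

Definition flower_center (l s t : nat) : {set flower_vertex l s t} :=
  [set inl i | i : 'I_s].

Definition flower_twins (l s t : nat) (j : 'I_l) :
    {set flower_vertex l s t} :=
  [set inr (j, i) | i : 'I_t].

Definition flower_edge (l s t : nat) (j : 'I_l) : {set flower_vertex l s t} :=
  flower_center l s t :|: flower_twins s t j.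

Definition flower_edges (l s t : nat) : {set {set flower_vertex l s t}} :=
  [set flower_edge s t j | j : 'I_l].

Lemma card_flower_edge (l s t : nat) (e : {set flower_vertex l s t}) :
  e \in flower_edges l s t -> #|e| = (s + t)%N.
Proof.
case/imsetP=> j _ ->; rewrite cardsU.
rewrite (_ : _ :&: _ = set0) ?cards0 ?subn0; last first.
  apply/setP=> x; rewrite !inE; apply/andP=> -[].
  by case/imsetP=> a _ -> /imsetP[b _].
rewrite !card_imset ?card_ord //; first by move=> a b [].
by move=> a b [].
Qed.

Lemma flower_edge_gt1 (l s t : nat) (s_gt0 : (0 < s)%N) (t_gt0 : (0 < t)%N)
    (e : {set flower_vertex l s t}) :
  e \in flower_edges l s t -> (1 < #|e|)%N.
Proof. by move/card_flower_edge->; rewrite -(addn1 1) leq_add. Qed.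

Definition hyperflower (l s t : nat) (s_gt0 : (0 < s)%N) (t_gt0 : (0 < t)%N) :
    hypergraph (flower_vertex l s t) :=
  Hypergraph (flower_edge_gt1 (l := l) s_gt0 t_gt0).

Lemma hyperflower_uniform (l s t : nat)
    (s_gt0 : (0 < s)%N) (t_gt0 : (0 < t)%N) :
  uniform (s + t) (hyperflower l s_gt0 t_gt0).
Proof. by move=> e; apply: card_flower_edge. Qed.

(* [inr e] is the new vertex p_e. *)
Definition subdiv_vertex (V : finType) (H : hypergraph V) : finType :=
  (V + {e : {set V} | e \in hyperedges H})%type.

Definition subdiv_edge (V : finType) (H : hypergraph V)
    (e : {e : {set V} | e \in hyperedges H}) (v : V) :
    {set subdiv_vertex H} :=
  inr e |: [set inl x | x in val e :\ v].

(* Subdividing one hyperedge leaves the other ones untouched, so all the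
   hyperedges of [H] are subdivided simultaneously. *)
Definition subdiv_edges (V : finType) (H : hypergraph V) :
    {set {set subdiv_vertex H}} :=
  \bigcup_(e : {e : {set V} | e \in hyperedges H})
    [set subdiv_edge e v | v in val e].

Lemma card_subdiv_edge (V : finType) (H : hypergraph V)
    (e : {e : {set V} | e \in hyperedges H}) (v : V) :
  v \in val e -> #|subdiv_edge e v| = #|val e|.
Proof.
move=> ve; rewrite cardsU1 card_imset; last by move=> a b [].
rewrite (cardsD1 v (val e)) ve; congr (_ + _)%N.
by case: imsetP => // -[x].
Qed.

Lemma subdiv_edge_gt1 (V : finType) (H : hypergraph V)
    (f : {set subdiv_vertex H}) :
  f \in subdiv_edges H -> (1 < #|f|)%N.
Proof.
case/bigcupP=> e _ /imsetP[v ve ->]; rewrite card_subdiv_edge //.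
exact: hyperedge_card (valP e).
Qed.

Definition subdivision (V : finType) (H : hypergraph V) :
    hypergraph (subdiv_vertex H) :=
  Hypergraph (@subdiv_edge_gt1 V H).

Lemma subdivision_uniform (V : finType) (k : nat) (H : hypergraph V) :
  uniform k H -> uniform k (subdivision H).
Proof.
move=> uH f /bigcupP[e _ /imsetP[v ve ->]].
by rewrite card_subdiv_edge // uH // (valP e).
Qed.

(* Main.v *)
(* Let M be the vertex-hyperedge incidence matrix of a k-uniform hypergraph H,
   and put c = (k - 2) / (k - 1).  The adjacency matrix of S(H) has blocks
   c (M M^T - Deg), M, M^T and 0.  Hence z - A(S(H)) is diagonal up to a
   product that factors through two copies of the hyperedge set, and
   Sylvester's identity det (1 - A B) = det (1 - B A) turns its determinant into
   z ^ #|E| * det D * det (1 - (c + 1 / z) M^T D^-1 M), where D is the diagonal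
   matrix of the z + c deg v.  For a hyperflower M^T D^-1 M is a combination of
   the identity and all-ones matrices, which gives the factorisation for all
   z > 0, hence as polynomials. *)
Require Import Defs.
From HB Require Import structures.
From mathcomp Require Import all_boot all_order all_algebra.
From mathcomp Require Import ring lra.
Import Order.TTheory GRing.Theory Num.Theory.
Local Open Scope ring_scope.

Local Notation hyperedge_of H := {e | e \in hyperedges H}.

(** * Determinant identities *)

(** Schur complement of the identity block: a unitriangular factor on the right clears [C]. *)
Lemma det_block_mx1 (R : comNzRingType) (m n : nat) (A : 'M[R]_m)
    (B : 'M[R]_(m, n)) (C : 'M[R]_(n, m)) :
  \det (block_mx A B C 1%:M) = \det (A - B *m C).
Proof.
have: block_mx A B C 1%:M *m block_mx 1%:M 0 (- C) 1%:M
    = block_mx (A - B *m C) B 0 1%:M.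
  by rewrite mulmx_block !(mulmx1, mul1mx, mulmx0, mulmxN, add0r, addrN).
move/(congr1 determinant).
by rewrite det_mulmx det_lblock det_ublock !det1 !mulr1.
Qed.

(** Both sides are Schur complements of one block matrix whose diagonal blocks are identities. *)
Lemma det_one_sub_mulmxC (R : comNzRingType) (m n : nat)
    (A : 'M[R]_(m, n)) (B : 'M[R]_(n, m)) :
  \det (1%:M - A *m B) = \det (1%:M - B *m A).
Proof.
rewrite -det_block_mx1.
have: block_mx 1%:M 0 (- B) 1%:M *m block_mx 1%:M A B 1%:M
    = block_mx 1%:M A 0 (1%:M - B *m A).
  rewrite mulmx_block !(mulmx1, mul1mx, mul0mx, mulNmx, addr0, addNr).
  by rewrite [- _ + _]addrC.
move/(congr1 determinant).
by rewrite det_mulmx det_lblock det_ublock !det1 !mul1r.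
Qed.

(** The constant matrix has rank at most one, so for nonzero [a] Sylvester's identity reduces the
    determinant to size 1. *)
Lemma det_scalar_add_const (R : fieldType) (n : nat) (a b : R) : (0 < n)%N ->
  \det (a%:M + const_mx b : 'M[R]_n) = a ^+ (n - 1) * (a + n%:R * b).
Proof.
case: n => // n _; rewrite subn1 /=.
have [-> | an0] := eqVneq a 0.
  rewrite raddf0 !add0r.
  (* With [a = 0], size 1 relies on [0 ^+ 0 = 1]; any larger constant matrix has two equal rows. *)
  case: n => [|n]; first by rewrite det_mx11 mxE expr0 !mul1r.
  rewrite exprS !mul0r.
  by apply: (@determinant_alternate _ _ _ ord0 ord_max) => // j; rewrite !mxE.
have -> : a%:M + const_mx b = a *: (1%:M
    - (- a^-1 *: (const_mx b : 'cV[R]_n.+1)) *m (const_mx 1 : 'rV[R]_n.+1)).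
  apply/matrixP => i j; rewrite !mxE big_ord1 !mxE.
  by rewrite -[_ *+ _]mulr_natr -[in RHS]mulr_natr; field.
rewrite detZ det_one_sub_mulmxC -scalemxAr det_mx11 !mxE.
under eq_bigr do rewrite !mxE mul1r.
rewrite sumr_const card_ord eqxx exprSr -mulrA; congr (_ * _).
by rewrite -[b *+ _]mulr_natl mulr1n; field.
Qed.

(** * Polynomials: comparison at positive points, and cubics with three real roots *)

(** The difference vanishes at 1, 2, 3 and so on, at as many points as its size. Positive points
    keep all later denominators nonzero. *)
Lemma poly_eq_pos (R : numFieldType) (p q : {poly R}) :
  (forall x, 0 < x -> p.[x] = q.[x]) -> p = q.
Proof.
move=> eqpq; apply/eqP; rewrite -subr_eq0; apply/eqP.
apply: (@roots_geq_poly_eq0 _ _ [seq i.+1%:R | i <- iota 0 (size (p - q))]).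
- apply/allP => _ /mapP[i _ ->]; rewrite rootE hornerD hornerN eqpq ?ltr0Sn //.
  by rewrite subrr.
- by rewrite map_inj_uniq ?iota_uniq // => i j /eqP; rewrite eqr_nat => /eqP[].
- by rewrite size_map size_iota.
Qed.

Lemma horner_char_poly (R : comNzRingType) (n : nat) (A : 'M[R]_n) (x : R) :
  (char_poly A).[x] = \det (x%:M - A).
Proof.
rewrite /char_poly -horner_evalE -det_map_mx; congr (\det _).
apply/matrixP => i j; rewrite !mxE /= horner_evalE hornerD hornerN hornerMn.
by rewrite hornerX hornerC.
Qed.

(* The intermediate value theorem gives a root [r <= 0]; the other two roots have
   product [v] with [r * v = c >= 0], so [v <= 0] and they are real. *)
Lemma cubic_splits (R : rcfType) (a b c : R) (y : R) :
  y <= 0 -> 0 <= b -> 0 <= c ->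
  0 <= ('X^3 - a *: 'X^2 - b *: 'X - c%:P).[y] ->
  exists r1 r2 r3 : R,
    'X^3 - a *: 'X^2 - b *: 'X - c%:P
    = \prod_(r <- [:: r1; r2; r3]) ('X - r%:P).
Proof.
move=> y0 b0 c0; set p := (X in X.[y]) => py.
(* The sign change must go from nonpositive to nonnegative, hence [- p], whose value at 0 is [c]. *)
have [|r /andP[_ r0] pr] := @poly_ivt R (- p) y 0 y0.
  rewrite !hornerN oppr_le0 py /= oppr_ge0.
  by rewrite /p !hornerE /=; lra.
have {pr} pr : p.[r] = 0.
  by move: pr; rewrite rootE hornerN oppr_eq0 => /eqP.
have pr' : r ^+ 3 - a * r ^+ 2 - b * r - c = 0.
  by rewrite -pr /p !hornerE /=; ring.
have cE : c = r ^+ 3 - a * r ^+ 2 - b * r.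
  by apply/eqP; rewrite eq_sym -subr_eq0 pr'.
(* The quotient of the cubic by ['X - r] is X^2 + u X + v. *)
pose u := r - a; pose v := r * u - b.
have v0 : v <= 0.
  move: r0; rewrite le_eqVlt => /orP[/eqP r0|r0]; first by rewrite /v r0; lra.
  have rv : r * v = c by rewrite cE /v /u; ring.
  by rewrite -(nmulr_rge0 _ r0) rv.
have d0 : 0 <= u ^+ 2 - 4 * v by have := sqr_ge0 u; lra.
set s := Num.sqrt (u ^+ 2 - 4 * v).
have s2 : s ^+ 2 = u ^+ 2 - 4 * v by rewrite sqr_sqrtr.
exists r, ((- u + s) / 2), ((- u - s) / 2).
rewrite !big_cons big_nil mulr1 /p.
apply: poly_eq_pos => x _; rewrite !hornerE /=.
transitivity ((x - r) * ((x + u / 2) ^+ 2 - s ^+ 2 / 4)); last by field.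
by rewrite s2 cE /v /u; field.
Qed.

(** * Codegrees in the subdivision hypergraph *)

Lemma codegreeE (V : finType) (H : hypergraph V) (u v : V) :
  codegree H u v
  = (\sum_(e : hyperedge_of H) ((u \in val e) && (v \in val e)))%N.
Proof.
rewrite -(big_sub (hyperedges H) (fun e => (u \in e) && (v \in e) : nat)).
rewrite /codegree -sum1_card [LHS]big_mkcond [RHS]big_mkcond /=.
by apply: eq_bigr => e _; rewrite inE; case: (e \in _) => //=; case: (_ && _).
Qed.

Lemma codegreeC (V : finType) (H : hypergraph V) (u v : V) :
  codegree H u v = codegree H v u.
Proof. by rewrite !codegreeE; apply: eq_bigr => e _; rewrite andbC. Qed.

Lemma inl_subdiv_edge (V : finType) (H : hypergraph V) (e : hyperedge_of H)
    (v u : V) :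
  (inl u \in subdiv_edge e v) = (u \in val e :\ v).
Proof. by rewrite !inE /= mem_imset ?inE // => a b []. Qed.

Lemma inr_subdiv_edge (V : finType) (H : hypergraph V) (e f : hyperedge_of H)
    (v : V) :
  (inr f \in subdiv_edge e v) = (f == e).
Proof.
rewrite !inE; case: imsetP => [[] //|_].
by rewrite orbF; apply/eqP/eqP => [[]|->].
Qed.

(** The pairs [(e, v)] with [v] in [e] index the new hyperedges without repetition: the new vertex
    determines [e], and [v] is the only vertex of [e] left out. *)
Lemma codegree_subdivisionE (V : finType) (H : hypergraph V)
    (x y : subdiv_vertex H) :
  codegree (subdivision H) x y
  = (\sum_(e : hyperedge_of H) \sum_(v in val e)
       ((x \in subdiv_edge e v) && (y \in subdiv_edge e v)))%N.
Proof.
have -> : codegree (subdivision H) x y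
    = (\sum_(f in subdiv_edges H) ((x \in f) && (y \in f)))%N.
  rewrite /codegree -sum1_card [LHS]big_mkcond [RHS]big_mkcond /=.
  by apply: eq_bigr => f _; rewrite inE; case: (f \in _) => //=; case: (_ && _).
rewrite partition_disjoint_bigcup => [|e f].
  apply: eq_bigr => e _; apply: big_imset => v w ve we.
  move/setP/(_ (inl v)); rewrite !inl_subdiv_edge !inE eqxx ve andbT /=.
  by rewrite andbT => /esym/negbFE/eqP.
apply: contraR => /pred0Pn[_ /andP[/imsetP[v _ ->] /imsetP[w _]]].
by move/setP/(_ (inr e)); rewrite !inr_subdiv_edge eqxx => /esym.
Qed.

Section SubdivisionCodegree.
Variables (V : finType) (k : nat) (H : hypergraph V).
Hypothesis uH : uniform k H.

(** Inside a hyperedge containing both vertices, the omitted vertex is any of the [k - 2] others. *)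
Lemma codegree_subdivision_inl_inl (u v : V) : u != v ->
  codegree (subdivision H) (inl u) (inl v) = ((k - 2) * codegree H u v)%N.
Proof.
move=> uv; rewrite codegree_subdivisionE codegreeE big_distrr /=.
apply: eq_bigr => e _.
have [/andP[ue ve]|/negbTE nuv] := boolP (_ && _); last first.
  rewrite muln0 big1 // => w _; rewrite !inl_subdiv_edge !inE.
  by rewrite andbACA nuv andbF.
rewrite muln1 -(uH _ (valP e)) (cardsD1 u) ue (cardsD1 v) !inE eq_sym uv ve.
rewrite addnA addKn -sum1_card [LHS]big_mkcond [RHS]big_mkcond /=.
apply: eq_bigr => w _; rewrite !inl_subdiv_edge !inE ue ve !andbT.
rewrite [w == v]eq_sym [w == u]eq_sym.
by case: (w \in _); case: (u == w); case: (v == w).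
Qed.

Lemma codegree_subdivision_inl_inr (u : V) (e : hyperedge_of H) :
  codegree (subdivision H) (inl u) (inr e) = ((k - 1) * (u \in val e))%N.
Proof.
rewrite codegree_subdivisionE (bigD1 e) //=.
rewrite [X in (_ + X)%N]big1 => [|f]; last first.
  move=> /negbTE fe; rewrite big1 // => v _.
  by rewrite inr_subdiv_edge eq_sym fe andbF.
rewrite addn0 -(uH _ (valP e)).
have [ue|/negbTE ue] := boolP (_ \in _); last first.
  by rewrite muln0 big1 // => v _; rewrite inl_subdiv_edge !inE ue andbF.
rewrite muln1 (cardsD1 u) ue addKn -sum1_card [LHS]big_mkcond [RHS]big_mkcond.
apply: eq_bigr => v _.
rewrite inl_subdiv_edge inr_subdiv_edge eqxx !inE ue eq_sym.
by case: (_ \in _); case: (_ == _).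
Qed.

Lemma codegree_subdivision_inr_inr (e f : hyperedge_of H) : e != f ->
  codegree (subdivision H) (inr e) (inr f) = 0%N.
Proof.
move=> /negbTE ef; rewrite codegree_subdivisionE big1 // => g _.
rewrite big1 // => v _; rewrite !inr_subdiv_edge.
by case: eqP => //= <-; rewrite eq_sym ef.
Qed.

End SubdivisionCodegree.

(** * Characteristic polynomial of the subdivision of a uniform hypergraph *)

Section CharPolySubdivision.
Variables (R : numFieldType) (V : finType) (k : nat) (H : hypergraph V).
Hypotheses (k_gt1 : (1 < k)%N) (uH : uniform k H).
Local Notation SV := (subdiv_vertex H).
Local Notation E := (hyperedge_of H).

Let c : R := (k%:R - 2) / (k%:R - 1).

(** Both [inc] and [new] have rows indexed by all vertices of the subdivision: [inc] is the
    incidence matrix above a zero block, [new] a zero block above the identity. *)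
Let inc (x : SV) (e : E) : R := if x is inl v then (v \in val e)%:R else 0.
Let new (x : SV) (e : E) : R := (x == inr e)%:R.

Let k1_neq0 : k%:R - 1 != 0 :> R.
Proof. by rewrite subr_eq0 pnatr_eq1 gtn_eqF. Qed.

Let sum_inc (u v : V) :
  \sum_(e : E) inc (inl u) e * inc (inl v) e = (codegree H u v)%:R.
Proof.
rewrite codegreeE natr_sum; apply: eq_bigr => e _ /=.
by rewrite -natrM mulnb.
Qed.

Let sum_new (e : E) (F : E -> R) : \sum_f F f * new (inr e) f = F e.
Proof.
rewrite (bigD1 e) //= /new eqxx mulr1 big1 ?addr0 // => f fe.
by rewrite (inj_eq inr_inj) eq_sym (negbTE fe) mulr0.
Qed.

Let codegree_subdivision (x y : SV) : x != y ->
  (codegree (subdivision H) x y)%:R / (k%:R - 1)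
  = \sum_e (inc x e * (c * inc y e + new y e) + new x e * inc y e).
Proof.
have natrB1 : (k - 1)%:R = k%:R - 1 :> R by rewrite natrB // ltnW.
case: x y => [u|e] [v|f] xy.
- rewrite (codegree_subdivision_inl_inl _ _ _ uH) //.
  rewrite natrM natrB // mulrAC -/c -sum_inc mulr_sumr.
  by apply: eq_bigr => e _; rewrite /= /new mul0r !addr0 mulrCA.
- rewrite (codegree_subdivision_inl_inr _ _ _ uH) natrM natrB1.
  rewrite mulrAC divff // mul1r.
  under eq_bigr do rewrite /= mulr0 mulr0 add0r addr0.
  by rewrite sum_new.
- rewrite codegreeC (codegree_subdivision_inl_inr _ _ _ uH) natrM natrB1.
  rewrite mulrAC divff // mul1r.
  under eq_bigr do rewrite /= mul0r add0r mulrC.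
  by rewrite sum_new.
- rewrite codegree_subdivision_inr_inr // mul0r big1 // => g _.
  by rewrite /= mul0r mulr0 addr0.
Qed.

Variable z : R.
(** The diagonal of c M M^T is c deg v while that of the adjacency matrix is 0; the term added to
    [z] compensates for this. *)
Let wt (x : SV) : R := if x is inl v then z + c * (codegree H v v)%:R else z.
Hypothesis wt_neq0 : forall x, wt x != 0.

Let M : 'M[R]_(#|{: SV}|, #|{: E}|) :=
  \matrix_(i, e) inc (enum_val i) (enum_val e).
Let P : 'M[R]_(#|{: SV}|, #|{: E}|) :=
  \matrix_(i, e) new (enum_val i) (enum_val e).
Let D := diag_mx (\row_i wt (enum_val i) : 'rV_#|{: SV}|).
Let D' := diag_mx (\row_i (wt (enum_val i))^-1 : 'rV_#|{: SV}|).

Let sum_enum (T : finType) (F : T -> R) :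
  \sum_(i < #|T|) F (enum_val i) = \sum_x F x.
Proof. by rewrite -big_enum_val. Qed.

Let subdivisionE :
  z%:M - adjmx R k (subdivision H)
  = D - row_mx M P *m col_mx (c *: M^T + P^T) M^T.
Proof.
have entry i j : (row_mx M P *m col_mx (c *: M^T + P^T) M^T) i j
    = \sum_e (inc (enum_val i) e * (c * inc (enum_val j) e + new (enum_val j) e)
              + new (enum_val i) e * inc (enum_val j) e).
  rewrite mul_row_col !mxE -[RHS]sum_enum -big_split /=.
  by apply: eq_bigr => e _; rewrite !mxE.
apply/matrixP => i j; rewrite mxE [RHS]mxE [X in _ = _ + X]mxE entry !mxE.
have [->|ij] := eqVneq i j; last first.
  rewrite !mulr0n codegree_subdivision //.
  by apply: contra ij => /eqP/enum_val_inj ->.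
rewrite /= !mulr1n subr0; case: (enum_val j) => [v|e] /=.
  under eq_bigr do rewrite /new mul0r !addr0 mulrCA.
  by rewrite -mulr_sumr sum_inc addrK.
by rewrite big1 ?subr0 // => e' _; rewrite mul0r mulr0 addr0.
Qed.

(** This and the next three facts give the blocks that appear once Sylvester's identity has swapped
    the factors. The mixed ones vanish because [M] and [P] are supported on disjoint sets of
    rows. *)
Let MDM : M^T *m (D' *m M) = \matrix_(i < #|{: E}|, j < #|{: E}|)
  \sum_v ((v \in val (enum_val i)) && (v \in val (enum_val j)))%:R
         / (z + c * (codegree H v v)%:R).
Proof.
apply/matrixP => i j; rewrite !mxE.
transitivity (\sum_x inc x (enum_val i) * ((wt x)^-1 * inc x (enum_val j))).
  by rewrite -[RHS]sum_enum; apply: eq_bigr => x _; rewrite mul_diag_mx !mxE.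
rewrite big_sumType /= [X in _ + X]big1 ?addr0 => [|e _]; last first.
  by rewrite mul0r.
by apply: eq_bigr => v _; rewrite mulrCA mulrC -natrM mulnb.
Qed.

Let MDP : M^T *m (D' *m P) = 0.
Proof.
apply/matrixP => i j; rewrite !mxE big1 // => x _.
rewrite mul_diag_mx !mxE; case: (enum_val x) => [v|e] /=.
  by rewrite /new !mulr0.
by rewrite mul0r.
Qed.

Let PDM : P^T *m (D' *m M) = 0.
Proof.
apply/matrixP => i j; rewrite !mxE big1 // => x _.
rewrite mul_diag_mx !mxE; case: (enum_val x) => [v|e] /=.
  by rewrite /new mul0r.
by rewrite !mulr0.
Qed.

Let PDP : P^T *m (D' *m P) = z^-1%:M.
Proof.
apply/matrixP => i j; rewrite !mxE.
transitivity (\sum_x new x (enum_val i) * ((wt x)^-1 * new x (enum_val j))).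
  by rewrite -[RHS]sum_enum; apply: eq_bigr => x _; rewrite mul_diag_mx !mxE.
rewrite (bigD1 (inr (enum_val i))) //= /new eqxx mul1r.
rewrite big1 ?addr0 => [|x /negbTE ->]; last by rewrite mul0r.
by rewrite mulr_natr (inj_eq inr_inj) (inj_eq enum_val_inj).
Qed.

Lemma horner_char_poly_subdivision :
  (char_poly (adjmx R k (subdivision H))).[z]
  = z ^+ #|{: E}| * \prod_v (z + c * (codegree H v v)%:R)
    * \det (1%:M - (c + z^-1) *: \matrix_(i < #|{: E}|, j < #|{: E}|)
        \sum_v ((v \in val (enum_val i)) && (v \in val (enum_val j)))%:R
               / (z + c * (codegree H v v)%:R)).
Proof.
rewrite horner_char_poly subdivisionE.
have -> : D - row_mx M P *m col_mx (c *: M^T + P^T) M^T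
    = D *m (1%:M - (D' *m row_mx M P) *m col_mx (c *: M^T + P^T) M^T).
  have DD' : D *m D' = 1%:M.
    by apply/matrixP => i j; rewrite mul_diag_mx !mxE mulrnAr divff.
  by rewrite mulmxBr mulmx1 !mulmxA DD' mul1mx.
rewrite det_mulmx det_diag; congr (_ * _).
  under eq_bigr do rewrite mxE.
  rewrite -(big_enum_val wt) big_sumType mulrC /=.
  by rewrite prodr_const.
rewrite det_one_sub_mulmxC mul_mx_row mul_col_row !mulmxDl -!scalemxAl.
(* Writing N for M^T D^-1 M, the remaining matrix has rows (1 - c N, - 1 / z) and (- N, 1), with
   Schur complement 1 - (c + 1 / z) N. *)
rewrite MDM MDP PDM PDP scaler0 addr0 add0r scalar_mx_block.
rewrite opp_block_mx add_block_mx oppr0 addr0 sub0r.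
rewrite sub0r det_block_mx1 mulNmx mulmxN opprK mul_scalar_mx.
by rewrite scalerDl opprD addrA.
Qed.

End CharPolySubdivision.

(** * Hyperflowers: degrees, common vertices and the factorisation *)

Section Hyperflower.
Variables (l s t : nat) (hs : (0 < s)%N) (ht : (0 < t)%N).
Local Notation H := (hyperflower l hs ht).

Lemma inl_flower_edge (i : 'I_s) (j : 'I_l) : inl i \in flower_edge s t j.
Proof. by rewrite inE imset_f. Qed.

Lemma inr_flower_edge (j j' : 'I_l) (i : 'I_t) :
  (inr (j', i) \in flower_edge s t j) = (j' == j).
Proof.
rewrite inE; apply/orP/eqP => [[/imsetP[]//|/imsetP[i' _ [->]//]]|->].
by right; rewrite imset_f.
Qed.

(** As [0 < t], each hyperedge has a twin, which lies in no other hyperedge. *)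
Lemma flower_edge_inj : injective (@flower_edge l s t).
Proof.
move=> j j' /setP/(_ (inr (j, Ordinal ht))).
by rewrite !inr_flower_edge eqxx => /esym/eqP.
Qed.

Lemma card_hyperflower : #|{: hyperedge_of H}| = l.
Proof. by rewrite card_sig card_imset ?card_ord //; apply: flower_edge_inj. Qed.

Lemma codegree_hyperflower (u v : flower_vertex l s t) :
  codegree H u v
  = (\sum_j ((u \in flower_edge s t j) && (v \in flower_edge s t j)))%N.
Proof.
rewrite codegreeE.
rewrite -(big_sub (hyperedges H) (fun e => (u \in e) && (v \in e) : nat)).
by apply: big_imset => j j' _ _; apply: flower_edge_inj.
Qed.

Lemma degree_flower_center (i : 'I_s) : codegree H (inl i) (inl i) = l.
Proof.
rewrite codegree_hyperflower.
under eq_bigr do rewrite inl_flower_edge.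
by rewrite sum1_card card_ord.
Qed.

Lemma degree_flower_twin (x : 'I_l * 'I_t) : codegree H (inr x) (inr x) = 1%N.
Proof.
case: x => j i; rewrite codegree_hyperflower (bigD1 j) //= big1 => [|j' j'j].
  by rewrite inr_flower_edge eqxx.
by rewrite inr_flower_edge eq_sym (negbTE j'j).
Qed.

(** Two distinct hyperedges share exactly the center, where degrees are [l]; twins, of degree 1,
    count only when [e = e']. Taking for [f] the inverse weight gives the entries of M^T D^-1 M. *)
Lemma sum_common_vertices_hyperflower (R : fieldType) (f : nat -> R)
    (e e' : hyperedge_of H) :
  \sum_v ((v \in val e) && (v \in val e'))%:R * f (codegree H v v)
  = (e == e')%:R * (t%:R * f 1%N) + s%:R * f l.
Proof.
have /imsetP[j _ ej] := valP e; have /imsetP[j' _ ej'] := valP e'.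
rewrite -val_eqE ej ej' /= (inj_eq flower_edge_inj) big_sumType /= addrC.
congr (_ + _).
  under eq_bigr do rewrite degree_flower_twin.
  rewrite -mulr_suml mulrA; congr (_ * _).
  transitivity (\sum_(a < l) \sum_(i < t) ((a == j) && (a == j'))%:R : R).
    rewrite pair_bigA /=; apply: eq_bigr => -[a i] _.
    by rewrite !inr_flower_edge.
  under eq_bigr do rewrite sumr_const card_ord.
  rewrite (bigD1 j) //= big1 => [|a /negbTE->]; last by rewrite mul0rn.
  by rewrite eqxx addr0 mulr_natr.
under eq_bigr do rewrite degree_flower_center !inl_flower_edge mul1r.
by rewrite sumr_const card_ord mulr_natl.
Qed.

Lemma horner_char_poly_subdivision_hyperflower (R : numFieldType) (z : R) :
  (0 < l)%N -> 0 < z ->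
  let c := ((s + t)%:R - 2) / ((s + t)%:R - 1) in
  (char_poly (adjmx R (s + t) (subdivision H))).[z]
  = (z + c) ^+ (l * (t - 1)) * (z + l%:R * c) ^+ (s - 1)
    * (z ^+ 2 - (t%:R - 1) * c * z - t%:R) ^+ (l - 1)
    * (z ^+ 3 - c * (l%:R * s%:R + t%:R - l%:R - 1) * z ^+ 2
       - (l%:R * s%:R + t%:R + l%:R * (s%:R + t%:R - 1) * c ^+ 2) * z
       - l%:R * (s%:R + t%:R) * c).
Proof.
move=> hl z_gt0 c.
have k_gt1 : (1 < s + t)%N by rewrite -(addn1 1) leq_add.
have c_ge0 : 0 <= c.
  by rewrite divr_ge0 // subr_ge0 ?(ler_nat _ 2) ?(ler_nat _ 1) // ltnW.
have zc : 0 < z + c by rewrite ltr_wpDr.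
have zlc : 0 < z + l%:R * c by rewrite ltr_wpDr // mulr_ge0.
have uH := @hyperflower_uniform l s t hs ht.
rewrite (horner_char_poly_subdivision _ _ _ _ k_gt1 uH) -/c; last first.
  case=> [v|e]; last by rewrite gt_eqF.
  by rewrite gt_eqF // ltr_wpDr // mulr_ge0.
pose g n := (z + c * n%:R)^-1.
pose a := 1 - (c + z^-1) * (t%:R * g 1%N).
pose b := - ((c + z^-1) * (s%:R * g l)).
have -> : 1%:M - (c + z^-1) *: \matrix_(i < #|{: hyperedge_of H}|,
    j < #|{: hyperedge_of H}|)
    \sum_v ((v \in val (enum_val i)) && (v \in val (enum_val j)))%:R
           / (z + c * (codegree H v v)%:R) = a%:M + const_mx b.
  apply/matrixP => i j; rewrite !mxE (sum_common_vertices_hyperflower _ g).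
  rewrite (inj_eq enum_val_inj) /a /b -[RHS]/(_ *+ _ + _) -[in RHS]mulr_natr.
  by ring.
rewrite det_scalar_add_const; rewrite card_hyperflower //.
rewrite big_sumType /=.
under eq_bigr do rewrite degree_flower_center.
under [X in _ * (_ * X) * _]eq_bigr do rewrite degree_flower_twin mulr1.
rewrite !prodr_const card_prod !card_ord.
have z0 : z != 0 by rewrite gt_eqF.
have zc0 : z + c != 0 by rewrite gt_eqF.
have zlc0 : z + l%:R * c != 0 by rewrite gt_eqF.
(* The determinant is a^(l - 1) (a + l b). Each of the [l - 1] factors [a] takes one z (z + c) from
   the prefactor, and a + l b takes z (z + c) (z + l c). This uses up z^l and leaves the exponents
   [l * (t - 1)] and [s - 1]. *)
have -> : z ^+ 2 - (t%:R - 1) * c * z - t%:R = z * (z + c) * a.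
  by rewrite /a /g mulr1; field; rewrite zc0.
have -> : z ^+ 3 - c * (l%:R * s%:R + t%:R - l%:R - 1) * z ^+ 2
       - (l%:R * s%:R + t%:R + l%:R * (s%:R + t%:R - 1) * c ^+ 2) * z
       - l%:R * (s%:R + t%:R) * c
    = z * (z + c) * (z + l%:R * c) * (a + l%:R * b).
  by rewrite /a /b /g mulr1 [c * l%:R]mulrC; field; apply/and3P.
rewrite !exprMn -{1}(subnK hl) -{1}(subnK hs).
have -> : (l * t = l * (t - 1) + (l - 1) + 1)%N.
  by rewrite -addnA subnK // -{3}[l]muln1 -mulnDr subnK.
by rewrite !exprD !expr1 [c * l%:R]mulrC; ring.
Qed.

End Hyperflower.

(** * Real roots of the cubic factor, and assembly of the spectrum *)

Lemma all_roots_scale_prod (R : fieldType) (a : R) (rs : seq R) : a != 0 ->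
  all_roots (a *: \prod_(r <- rs) ('X - r%:P)) rs.
Proof.
move=> a0; have mon := monic_prod_XsubC rs xpredT id.
split; first by rewrite scaler_eq0 negb_or a0 monic_neq0.
by rewrite lead_coefZ (monicP mon) mulr1.
Qed.

(* The cubic takes the value [l c s (l - 1) (1 - l c ^ 2)] at [- l c] and the
   value [(1 - c ^ 2) (l c ^ 2 - 1) / c ^ 3] at [- 1 / c], so one of these two
   nonpositive points always has a nonnegative image. *)
Lemma hyperflower_cubic_splits (R : rcfType) (l s t c : R) :
  1 <= l -> 0 <= s -> 0 <= t -> 1 <= s + t -> 0 <= c <= 1 ->
  exists r1 r2 r3 : R,
    'X^3 - (c * (l * s + t - l - 1)) *: 'X^2
      - (l * s + t + l * (s + t - 1) * c ^+ 2) *: 'X - (l * (s + t) * c)%:P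
    = \prod_(r <- [:: r1; r2; r3]) ('X - r%:P).
Proof.
move=> l1 s0 t0 st1 /andP[c_ge0 c_le1].
have l0 : 0 <= l by apply: le_trans l1.
set A := c * _; set B := _ + l * _ * _; set C := l * _ * c.
have B_ge0 : 0 <= B.
  by rewrite addr_ge0 ?addr_ge0 // !mulr_ge0 // subr_ge0.
have C_ge0 : 0 <= C by rewrite !mulr_ge0 // addr_ge0.
have [lc1|lc1] := lerP (l * c ^+ 2) 1.
  apply: (@cubic_splits R _ _ _ (- (l * c))) => //.
    by rewrite oppr_le0 mulr_ge0.
  rewrite (_ : _.[_] = l * c * s * ((l - 1) * (1 - l * c ^+ 2))).
    by rewrite !mulr_ge0 // subr_ge0.
  by rewrite !hornerE /= /A /B /C; ring.
have c0 : c != 0 by apply: contraTneq lc1 => ->; rewrite expr0n mulr0 ltr10.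
apply: (@cubic_splits R _ _ _ (- c^-1)) => //.
  by rewrite oppr_le0 invr_ge0.
rewrite (_ : _.[_] = c^-1 ^+ 3 * ((1 - c ^+ 2) * (l * c ^+ 2 - 1))).
  by rewrite !mulr_ge0 ?exprn_ge0 ?invr_ge0 // subr_ge0 ?exprn_ile1 // ltW.
by rewrite !hornerE /= /A /B /C; field.
Qed.

Theorem theorem3 (R : rcfType) (l s t k : nat)
  (hl : (0 < l)%N) (hs : (0 < s)%N) (ht : (0 < t)%N) (hk : k = (s + t)%N) :
  exists r1 r2 r3 : R,
    all_roots
      (((k%:R - 1) ^+ 2) *: 'X^3
       - ((k%:R - 1) * (k%:R - 2) * (l%:R * s%:R + t%:R - l%:R - 1)) *: 'X^2
       - ((l%:R * s%:R + t%:R) * (k%:R - 1) ^+ 2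
          + l%:R * (s%:R + t%:R - 1) * (k%:R - 2) ^+ 2) *: 'X
       - (l%:R * (s%:R + t%:R) * (k%:R - 1) * (k%:R - 2))%:P)
      [:: r1; r2; r3]
    /\ spectrum (adjmx R k (subdivision (hyperflower l hs ht)))
      (nseq (l * (t - 1)) (- ((k%:R - 2) / (k%:R - 1)))
       ++ nseq (s - 1) (- (l%:R * (k%:R - 2) / (k%:R - 1)))
       ++ nseq (l - 1)
            (((t%:R - 1) * (k%:R - 2)
              + Num.sqrt ((t%:R - 1) ^+ 2 * (k%:R - 2) ^+ 2
                          + 4 * t%:R * (k%:R - 1) ^+ 2))
             / (2 * (k%:R - 1)))
       ++ nseq (l - 1)
            (((t%:R - 1) * (k%:R - 2)
              - Num.sqrt ((t%:R - 1) ^+ 2 * (k%:R - 2) ^+ 2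
                          + 4 * t%:R * (k%:R - 1) ^+ 2))
             / (2 * (k%:R - 1)))
       ++ [:: r1; r2; r3]).
Proof.
subst k; set w := Num.sqrt _.
have w2 : w ^+ 2 = (t%:R - 1) ^+ 2 * ((s + t)%:R - 2) ^+ 2
    + 4 * t%:R * ((s + t)%:R - 1) ^+ 2.
  rewrite sqr_sqrtr //.
  by apply: addr_ge0; apply: mulr_ge0; rewrite ?sqr_ge0 // mulr_ge0.
have k_gt1 : (1 < s + t)%N by rewrite -(addn1 1) leq_add.
have k1_neq0 : (s + t)%:R - 1 != 0 :> R by rewrite subr_eq0 pnatr_eq1 gtn_eqF.
set c : R := ((s + t)%:R - 2) / ((s + t)%:R - 1).
have c_ge0 : 0 <= c.
  by rewrite divr_ge0 // subr_ge0 ?(ler_nat _ 2) ?(ler_nat _ 1) // ltnW.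
have c_le1 : c <= 1.
  rewrite ler_pdivrMr ?mul1r; first by rewrite lerD2l lerN2 ler1n.
  by rewrite subr_gt0 ltr1n.
have l1 : 1 <= l%:R :> R by rewrite ler1n.
have [||||| r1 [r2 [r3 cubicE]]] :=
    @hyperflower_cubic_splits R l%:R s%:R t%:R c => //.
- by rewrite -natrD ler1n ltnW.
- by rewrite c_ge0.
exists r1, r2, r3; split.
  (* The stated cubic is (k - 1)^2 times the monic cubic in [c]. *)
  rewrite [X in all_roots X](_ : _
      = ((s + t)%:R - 1) ^+ 2 *: \prod_(r <- [:: r1; r2; r3]) ('X - r%:P)).
    by apply: all_roots_scale_prod; rewrite expf_neq0.
  rewrite -cubicE !scalerBr !scalerA -!mul_polyC -!polyCM.
  congr (_ - _%:P * _ - _%:P * _ - _%:P).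
  - by rewrite /c; field; rewrite -natrD.
  - by rewrite /c; field; rewrite -natrD.
  - by rewrite /c; field; rewrite -natrD.
rewrite /spectrum -[X in all_roots X _]scale1r.
set rs := (X in all_roots _ X).
suff -> : char_poly (adjmx R (s + t) (subdivision (hyperflower l hs ht)))
    = \prod_(r <- rs) ('X - r%:P).
  by apply: all_roots_scale_prod; rewrite oner_neq0.
apply: poly_eq_pos => z z_gt0.
rewrite horner_char_poly_subdivision_hyperflower // -/c.
rewrite /rs !big_cat /= -cubicE !big_nseq !iter_mulr_1 mulrA mulrA.
rewrite !(hornerM, horner_exp, hornerXsubC).
have -> : z ^+ 2 - (t%:R - 1) * c * z - t%:R
    = (z - ((t%:R - 1) * ((s + t)%:R - 2) + w) / (2 * ((s + t)%:R - 1)))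
      * (z - ((t%:R - 1) * ((s + t)%:R - 2) - w) / (2 * ((s + t)%:R - 1))).
  (* Completing the square: the quadratic has discriminant w^2 / (k - 1)^2. *)
  transitivity (
    (z - (t%:R - 1) * ((s + t)%:R - 2) / (2 * ((s + t)%:R - 1))) ^+ 2
    - w ^+ 2 / (2 * ((s + t)%:R - 1)) ^+ 2).
    by rewrite w2 /c; field; rewrite -natrD.
  by field; rewrite -natrD.
rewrite exprMn !opprK -[l%:R * _ / _]mulrA -/c !mulrA; congr (_ * _).
by clearbody c; rewrite !hornerE /=; ring.
Qed.
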